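(* Let $K$ be a field with $\operatorname{char} K = 2$, let $(V,Q)$ be a nondefective quadratic space of finite dimension over $K$, and let $\varphi \in \mathrm{O}(V,Q)$ be orthogonally indecomposable of type 1. (1) If $\varphi$ is of type 1e, then (a) $\varphi$ is hyperbolic, and (b) $\varphi$ is the unipotent factor in the multiplicative Jordan–Chevalley decomposition of a cyclic transformation in $\mathrm{O}(V,Q)$. (2) $\varphi$ has a square root in $\mathrm{O}(V,Q)$ if and only if $\varphi$ is of type 1o.
   Context: $Q$ is a quadratic form on $V$ with associated bilinear form $f_Q(u,w)=Q(u+w)-Q(u)-Q(w)$; $Q$ is nondefective if $f_Q$ is nondegenerate. A subspace is nondefective if the restriction of $f_Q$ to it is nondegenerate. $\mathrm{O}(V,Q)$ is the orthogonal group. $\varphi \in \mathrm{O}(V,Q)$ is orthogonally indecomposable if $V\neq 0$ has no proper nonzero nondefective $\varphi$-invariant subspace. Such a $\varphi$ (in characteristic 2) is of type 1 if it is bicyclic with exactly two elementary divisors $e_1=e_2=(x+1)^m$ for some $m\ge 1$; it is of type 1o if in addition its minimal polynomial has odd degree ($m$ odd), and of type 1e if its minimal polynomial has even degree ($m$ even). A subspace $W$ is totally isotropic if $Q(w)=0$ for all $w\in W$. $\varphi\in \mathrm{O}(V,Q)$ is hyperbolic if $V=U\oplus W$ for some totally isotropic $\varphi$-invariant subspaces $U$ and $W$. A transformation is cyclic if $V$ is generated by a single vector under its powers. The multiplicative Jordan–Chevalley decomposition of an invertible $\eta$ is $\eta=\eta_U\eta_S=\eta_S\eta_U$ with $\eta_U$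 unipotent and $\eta_S$ semisimple. *)

(* Defs.v *)
From HB Require Import structures.
From mathcomp Require Import all_boot all_order all_algebra.

Set Implicit Arguments.
Unset Strict Implicit.
Unset Printing Implicit Defensive.

Import GRing.Theory.
Local Open Scope ring_scope.

Section QuadraticSpaces.
Variables (K : fieldType) (V : vectType K).
Implicit Types (Q : V -> K) (U W : {vspace V}) (phi psi : 'End(V)).

Definition polar Q (u w : V) : K := Q (u + w) - Q u - Q w.

Definition quadratic_form Q : Prop :=
  [/\ forall (a : K) (v : V), Q (a *: v) = a ^+ 2 * Q v,
      forall w : V, scalar (polar Q ^~ w)
    & forall u : V, scalar (polar Q u)].

Definition nondefective_on Q U : Prop :=
  forall u, u \in U -> (forall w, w \in U -> polar Q u w = 0) -> u = 0.

Definition nondefective Q : Prop := nondefective_on Q fullv.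

Definition totally_isotropic Q W : Prop := forall w, w \in W -> Q w = 0.

Definition in_orthogonal_group Q phi : Prop :=
  bijective phi /\ forall v, Q (phi v) = Q v.

Definition invariant phi U : Prop := (phi @: U <= U)%VS.

Definition orthogonally_indecomposable Q phi : Prop :=
  {:V}%VS <> 0%VS /\
  forall U, invariant phi U -> nondefective_on Q U -> U = 0%VS \/ U = {:V}%VS.

Definition hyperbolic Q phi : Prop :=
  exists U W,
    [/\ totally_isotropic Q U /\ invariant phi U,
        totally_isotropic Q W /\ invariant phi W,
        (U + W)%VS = {:V}%VS & (U :&: W)%VS = 0%VS].

(* 'End(V) carries no canonical ring structure, since V may be 0. *)
Definition lfun_exp phi (n : nat) : 'End(V) := iter n (comp_lfun phi) \1%VF.

Definition lfun_horner (p : {poly K}) phi : 'End(V) :=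
  \sum_(i < size p) p`_i *: lfun_exp phi i.

(* By Cayley-Hamilton, the powers below the dimension of V span the same
   subspace as all powers. *)
Definition cyclic_span phi (v : V) : {vspace V} :=
  <<[seq lfun_exp phi i v | i <- iota 0 (\dim {:V})]>>%VS.

Definition cyclic_lfun phi : Prop := exists v, cyclic_span phi v = {:V}%VS.

Definition bicyclic_lfun phi : Prop :=
  ~ cyclic_lfun phi /\
  exists u w, (cyclic_span phi u + cyclic_span phi w)%VS = {:V}%VS.

Definition is_minimal_polynomial phi (p : {poly K}) : Prop :=
  [/\ p \is monic, lfun_horner p phi = 0
    & forall q : {poly K}, lfun_horner q phi = 0 -> p %| q].

Definition monic_prime_power (e : {poly K}) : Prop :=
  exists (p : {poly K}) (k : nat),
    [/\ p \is monic, irreducible_poly p, (0 < k)%N & e = p ^+ k].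

(* es lists the elementary divisors of phi, with multiplicity: the K['X]-module
   defined by phi on V is the direct sum of the K['X] / (e), e in es. *)
Definition elementary_divisors phi (es : seq {poly K}) : Prop :=
  (forall e, e \in es -> monic_prime_power e) /\
  exists v : 'I_(size es) -> V,
    [/\ forall (i : 'I_(size es)) (q : {poly K}),
          lfun_horner q phi (v i) = 0 <-> es`_i %| q,
        directv (\sum_(i < size es) cyclic_span phi (v i))
      & (\sum_(i < size es) cyclic_span phi (v i))%VS = {:V}%VS].

Definition type1 phi : Prop :=
  bicyclic_lfun phi /\
  exists m : nat, (0 < m)%N /\
    elementary_divisors phi [:: ('X + 1) ^+ m; ('X + 1) ^+ m].

Definition type1o phi : Prop :=
  type1 phi /\ exists p, is_minimal_polynomial phi p /\ odd (size p).-1.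

Definition type1e phi : Prop :=
  type1 phi /\ exists p, is_minimal_polynomial phi p /\ ~~ odd (size p).-1.

Definition unipotent phi : Prop := exists n, lfun_exp (phi - \1%VF) n = 0.

Definition semisimple phi : Prop :=
  forall U, invariant phi U ->
    exists W, [/\ invariant phi W, (U + W)%VS = {:V}%VS & (U :&: W)%VS = 0%VS].

Definition jordan_chevalley (eta etaU etaS : 'End(V)) : Prop :=
  [/\ eta = (etaU \o etaS)%VF, eta = (etaS \o etaU)%VF,
      unipotent etaU & semisimple etaS].

End QuadraticSpaces.

(* Main.v *)
Require Import Defs.
From HB Require Import structures.
From mathcomp Require Import all_boot all_order all_algebra.
From mathcomp Require Import zify ring.
Import GRing.Theory.
Local Open Scope ring_scope.

(** Let f be the polar form of Q, N = phi - 1, and let N* = phi^-1 - 1 be the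
    adjoint of N. In characteristic 2 the product s = N N* is also N + N*. So s
    is self-adjoint, N ^ 2 = s phi, and every polynomial in phi is a combination
    of 1 and N with coefficients in K[s]. All values f (N ^ i v) (N ^ j w) are
    therefore determined by the two sequences f (s ^ j v) w and f (N s ^ j v) w,
    which are called evenf and oddf below. As moreover Q (N v) = f v (N v), an
    endomorphism commuting with phi is an isometry as soon as it preserves these
    sequences and Q on generators (isometry_on_generators).

    If phi has the elementary divisors (x + 1) ^ m, (x + 1) ^ m, then V is free
    of rank 2 over K[x] / (x + 1) ^ m. The form f (N ^ (m - 1) v) w is symmetric
    and nondegenerate on V / N V. It is also alternating: always if m is odd,
    and by indecomposability if m is even, because a vector v with
    f (N ^ (m - 1) v) v != 0 would generate a nondefective cyclic subspace
    (indecomposable_top_alternating). Hence u and w form a basis of V over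
    K[x] / (x + 1) ^ m whenever f (N ^ (m - 1) u) w != 0. If a suitable multiple
    c N ^ i of u or w is added to one of them, then one chosen term of its sequences
    changes by a nonzero multiple of c, and the later terms remain as they are. This
    allows bases to be normalized by descending induction.

    If m is even, there is a basis u, w with Q = 0 on both cyclic submodules and
    f (s ^ j u) w = 0 for all j (hyperbolic_generators). So phi is hyperbolic.
    Moreover V then looks like a tensor product of an alternating form on
    K[x] / (x + 1) ^ m and an alternating form on K ^ 2, on which SL_2 (K) acts
    by isometries that commute with phi. Its element S of order 3 given by
    u |-> w |-> u + w exists over every field of characteristic 2. It is
    semisimple by Maschke's theorem, and phi S is cyclic, since S is a power of
    phi S and since u and S u generate V.

    If m > 1 is odd, there is a basis u, w on which Q and the sequences of u and w
    agree, with f (N s ^ j u) w = 0 for all j (symmetric_partner). Then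
    u |-> w |-> phi u defines an isometry whose square is phi.

    Finally, let psi be an isometry with psi ^ 2 = phi and m even. The element s for
    psi is a square root of the one for phi. It follows that the top form of psi is
    again alternating, as it takes the same values f (N ^ (m - 1) v) v at equal
    vectors as that of phi. So psi would need two Jordan blocks of size 2 m or
    2 m - 1, which is too much for a space of dimension 2 m (even_no_root). *)

(** * Powers of an endomorphism and cyclic modules *)

Section Powers.
Set Implicit Arguments.
Unset Strict Implicit.
Unset Printing Implicit Defensive.
Variables (K : fieldType) (V : vectType K).
Implicit Types (f g : 'End(V)) (v : V).
Local Notation invariant := Defs.invariant.
Arguments lfun_exp {K V} phi n : simpl never.

Lemma lfun_exp0 f v : lfun_exp f 0 v = v.
Proof. by rewrite /lfun_exp /= id_lfunE. Qed.

Lemma lfun_expS f n v : lfun_exp f n.+1 v = f (lfun_exp f n v).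
Proof. by rewrite /lfun_exp /= comp_lfunE. Qed.

Lemma lfun_expD f m n v : lfun_exp f (m + n) v = lfun_exp f m (lfun_exp f n v).
Proof.
elim: m => [|m IHm]; first by rewrite lfun_exp0.
by rewrite addSn !lfun_expS IHm.
Qed.

Lemma lfun_exp_commute f g n :
  (forall v, f (g v) = g (f v)) ->
  forall v, f (lfun_exp g n v) = lfun_exp g n (f v).
Proof.
move=> fg v; elim: n => [|n IHn]; first by rewrite !lfun_exp0.
by rewrite !lfun_expS fg IHn.
Qed.

Lemma lfun_expSr f n v : lfun_exp f n.+1 v = lfun_exp f n (f v).
Proof. by rewrite lfun_expS lfun_exp_commute. Qed.

Lemma lfun_exp_eq0 f m n :
  (forall v, lfun_exp f m v = 0) -> (m <= n)%N -> forall v, lfun_exp f n v = 0.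
Proof. by move=> f0 le_mn v; rewrite -(subnKC le_mn) lfun_expD f0. Qed.

Lemma invariantP f (X : {vspace V}) :
  invariant f X <-> forall v, v \in X -> f v \in X.
Proof.
split=> [/subvP fX v Xv | fX]; first exact/fX/memv_img.
by apply/subvP=> _ /memv_imgP[v Xv ->]; apply: fX.
Qed.

Lemma mem_lfun_exp f (X : {vspace V}) n v :
  invariant f X -> v \in X -> lfun_exp f n v \in X.
Proof.
move=> /invariantP fX Xv; elim: n => [|n IHn]; first by rewrite lfun_exp0.
by rewrite lfun_expS fX.
Qed.

(** The span of the first dim V iterates of a vector is already closed: either
    these iterates are independent and fill V, or the chain of spans has become
    stationary before. *)
Lemma cyclic_span_invariant f v : invariant f (cyclic_span f v).
Proof.
rewrite /cyclic_span.
set X := fun n => <<[seq lfun_exp f i v | i <- iota 0 n]>>%VS.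
have XS n : X n.+1 = (X n + <[lfun_exp f n v]>)%VS.
  by rewrite /X -addn1 iotaD map_cat span_cat /= span_seq1.
have H n : \dim (X n) = n \/ invariant f (X n) /\ v \in X n.
  elim: n => [|n [dimX | [inv Xv]]].
  - by left; rewrite /X /= span_nil dimv0.
  - have [Xn|nXn] := boolP (lfun_exp f n v \in X n).
      right; have -> : X n.+1 = X n by rewrite XS; apply/addv_idPl; rewrite -memvE.
      have Xv : v \in X n.
        case: n dimX Xn => [|n] ? Xn; first by rewrite lfun_exp0 in Xn.
        by apply: memv_span; rewrite /= lfun_exp0 mem_head.
      split=> //; rewrite /Defs.invariant limg_span.
      apply/span_subvP=> _ /mapP[_ /mapP[i lt_in ->] ->].
      move: lt_in; rewrite mem_iota add0n => /andP[_ lt_in]; rewrite -lfun_expS.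
      have [->//|ne] := eqVneq i.+1 n; apply: memv_span; apply/mapP.
      by exists i.+1; rewrite // mem_iota ltn_neqAle ne.
    left; rewrite XS dimv_disjoint_sum; last first.
      apply/eqP; rewrite -subv0; apply/subvP=> w; rewrite memv_cap.
      case/andP=> Xw /vlineP[c wE]; rewrite memv0 wE scaler_eq0.
      have [//|c0] := eqVneq c 0; case/negP: nXn.
      by rewrite -(scalerK c0 (lfun_exp f n v)) -wE memvZ.
    rewrite dimX dim_vline addnC; case: eqP nXn => [->|//].
    by rewrite mem0v.
  right; have -> // : X n.+1 = X n.
  by rewrite XS; apply/addv_idPl; rewrite -memvE mem_lfun_exp.
rewrite -[<<_>>%VS]/(X _); case: (H (\dim {:V})) => [dimX|[]//].
have -> : X (\dim {:V}) = {:V}%VS by apply/eqP; rewrite eqEdim subvf dimX leqnn.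
by apply/invariantP=> w _; rewrite memvf.
Qed.

(** * Families that are free over a truncated polynomial ring *)

Section Krylov.
Variables (f : 'End(V)) (n m : nat).
Implicit Types (e : 'I_n -> V) (x : 'M[K]_(n, m)).

(** The linear combination of the e l with coefficients in K['X] / ('X ^ m), where
    'X acts as f and the l-th coefficient is read off from row l of x. *)
Definition krylov e x : V := \sum_l \sum_i x l i *: lfun_exp f i (e l).

Fact krylov_linear e : linear (krylov e).
Proof.
move=> a x y; rewrite /krylov scaler_sumr -big_split; apply: eq_bigr => l _.
rewrite scaler_sumr -big_split; apply: eq_bigr => i _ /=.
by rewrite !mxE scalerDl scalerA.
Qed.
HB.instance Definition _ e :=
  GRing.isLinear.Build K 'M[K]_(n, m) V *:%R (krylov e) (krylov_linear e).

Lemma krylov_single e l (i : 'I_m) :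
  krylov e (delta_mx l i) = lfun_exp f i (e l).
Proof.
rewrite /krylov (bigD1 l) //= (bigD1 i) //= !mxE !eqxx scale1r.
rewrite !big1 ?addr0 // => [l' ne|i' ne].
  by rewrite big1 // => i' _; rewrite mxE (negbTE ne) scale0r.
by rewrite mxE eqxx (negbTE ne) scale0r.
Qed.

Lemma krylov_sub e (X : {vspace V}) x :
  invariant f X -> (forall l, e l \in X) -> krylov e x \in X.
Proof.
move=> fX eX; apply: memv_suml => l _; apply: memv_suml => i _.
by rewrite memvZ // mem_lfun_exp.
Qed.

(** Multiplication of all coefficients by 'X, modulo 'X ^ m. *)
Definition shift_mx x : 'M[K]_(n, m) :=
  \matrix_(l, i) \sum_(j < m | j.+1 == i :> nat) x l j.

Lemma krylov_shift e x : (forall v, lfun_exp f m v = 0) ->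
  f (krylov e x) = krylov e (shift_mx x).
Proof.
move=> f0; rewrite /krylov linear_sum; apply: eq_bigr => l _; rewrite linear_sum.
under [RHS]eq_bigr => i _ do rewrite mxE scaler_suml.
rewrite (exchange_big_dep predT) //=; apply: eq_bigr => j _.
rewrite linearZ /= -lfun_expS; have [lt_jm|ge_jm] := ltnP j.+1 m.
  by rewrite (big_pred1 (Ordinal lt_jm)).
rewrite big1 ?(lfun_exp_eq0 f0 ge_jm) ?scaler0 // => i /eqP ji.
by case: i ji => i lt_im /= ji; rewrite -ji ltnNge ge_jm in lt_im.
Qed.

Hypotheses (m_gt0 : (0 < m)%N) (f0 : forall v, lfun_exp f m v = 0).

(** In a nonzero combination, the lowest power of f that occurs can be brought
    up to f ^ (m - 1), and this kills all other terms. *)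
Lemma krylov_lowest e x : x != 0 ->
  exists a (c : 'I_n -> K), (exists l, c l != 0) /\
    lfun_exp f a (krylov e x) = \sum_l c l *: lfun_exp f m.-1 (e l).
Proof.
move=> x0; pose P i := [exists l, exists j : 'I_m, (j == i :> nat) && (x l j != 0)].
have exP : exists i, P i.
  have /existsP[l /existsP[j xlj]] : [exists l, exists j, x l j != 0].
    apply: contraR x0; rewrite negb_exists => /forallP x0.
    apply/eqP/matrixP=> l j; rewrite mxE; apply/eqP.
    by have := x0 l; rewrite negb_exists => /forallP/(_ j); rewrite negbK.
  by exists j; apply/existsP; exists l; apply/existsP; exists j; rewrite eqxx.
have [_ /existsP[l /existsP[i /andP[/eqP<- xli]]] min_i] := ex_minnP exP.
exists (m.-1 - i)%N, (fun l => x l i); split; first by exists l.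
rewrite /krylov linear_sum; apply: eq_bigr => l' _ /=.
rewrite linear_sum (bigD1 i) //= linearZ /= -lfun_expD subnK; last first.
  by case: (i) => /= *; lia.
rewrite big1 ?addr0 // => j ne; rewrite linearZ /=.
have [lt_ji|lt_ij|eq_ij] := ltngtP j i.
- have [->|xlj] := eqVneq (x l' j) 0; first by rewrite scale0r.
  suff /min_i : P j by rewrite leqNgt lt_ji.
  by apply/existsP; exists l'; apply/existsP; exists j; rewrite eqxx.
- by rewrite -lfun_expD (lfun_exp_eq0 f0) ?scaler0 //; lia.
- by case/eqP: ne; apply: val_inj.
Qed.

(** Dual form of Nakayama's lemma: independence over K['X] / ('X ^ m) can be tested
    on the images under f ^ (m - 1). *)
Lemma krylov_inj e :
    (forall c : 'I_n -> K,
       \sum_l c l *: lfun_exp f m.-1 (e l) = 0 -> forall l, c l = 0) ->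
  injective (krylov e).
Proof.
move=> indep; apply: raddf_inj => x x0.
have [//|/(krylov_lowest e)[a [c [[l /eqP cl]]]]] := eqVneq x 0.
by rewrite x0 linear0 => /esym/indep/(_ l).
Qed.

Lemma krylov_dim e : injective (krylov e) ->
  \dim (limg (linfun (krylov e))) = (n * m)%N.
Proof.
move=> inj; rewrite limg_dim_eq ?dimvf ?dim_matrix //.
apply/eqP; rewrite capfv; apply/lker0P=> x y; rewrite !lfunE /=; exact: inj.
Qed.

Lemma krylov_surj e : injective (krylov e) -> (n * m)%N = \dim {:V} ->
  forall v, exists x, v = krylov e x.
Proof.
move=> inj dimV v.
have: v \in limg (linfun (krylov e)).
  have /eqP-> : limg (linfun (krylov e)) == fullv; last exact: memvf.
  by rewrite eqEdim subvf krylov_dim // dimV leqnn.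
by case/memv_imgP=> x _ ->; exists x; rewrite lfunE.
Qed.

Lemma krylov_invariant e : invariant f (limg (linfun (krylov e))).
Proof.
apply/invariantP=> _ /memv_imgP[x _ ->]; rewrite lfunE krylov_shift //.
by rewrite -[krylov _ _]lfunE memv_img ?memvf.
Qed.

Lemma krylov_mem e l : e l \in limg (linfun (krylov e)).
Proof.
rewrite -(lfun_exp0 f (e l)) -(krylov_single e l (Ordinal m_gt0)).
by rewrite -[krylov _ _]lfunE memv_img ?memvf.
Qed.

(** Vectors that form a basis of V over K['X]/('X ^ m) can be sent to arbitrary
    vectors by an endomorphism commuting with f. *)
Lemma krylov_extend e e' : injective (krylov e) -> (n * m)%N = \dim {:V} ->
  exists g : 'End(V), (forall v, g (f v) = f (g v)) /\ forall l, g (e l) = e' l.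
Proof.
move=> inj dimV; pose L := linfun (krylov e).
have kL : lker L == 0%VS by apply/lker0P=> x y; rewrite !lfunE; exact: inj.
exists (linfun (krylov e') \o L^-1)%VF.
have gE x : (linfun (krylov e') \o L^-1)%VF (krylov e x) = krylov e' x.
  by rewrite comp_lfunE -[krylov e x]lfunE lker0_lfunK // lfunE.
split=> [v | l].
  have [x ->] := krylov_surj inj dimV v.
  by rewrite krylov_shift // !gE krylov_shift.
rewrite -(lfun_exp0 f (e l)) -(krylov_single e l (Ordinal m_gt0)) gE.
by rewrite krylov_single lfun_exp0.
Qed.

Lemma krylov_eq e x (g h : 'End(V)) :
    (forall v, g (f v) = f (g v)) -> (forall v, h (f v) = f (h v)) ->
    (forall l, g (e l) = h (e l)) ->
  g (krylov e x) = h (krylov e x).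
Proof.
move=> gf hf gh; rewrite /krylov !linear_sum; apply: eq_bigr => l _.
rewrite !linear_sum; apply: eq_bigr => i _; rewrite !linearZ /=.
by rewrite (lfun_exp_commute i gf) (lfun_exp_commute i hf) gh.
Qed.
End Krylov.

Lemma mem_cyclic_span f v : v \in cyclic_span f v.
Proof.
rewrite /cyclic_span; case: (\dim {:V}) (dimv_eq0 {:V}%VS) => [|d _].
  rewrite eqxx => /esym/eqP V0; have := memvf v.
  by rewrite V0 memv0 => /eqP->; rewrite mem0v.
by apply: memv_span; rewrite /= lfun_exp0 mem_head.
Qed.

Lemma cyclic_span_sub f v (X : {vspace V}) :
  invariant f X -> v \in X -> (cyclic_span f v <= X)%VS.
Proof. by move=> fX Xv; apply/span_subvP=> _ /mapP[i _ ->]; apply: mem_lfun_exp. Qed.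
End Powers.

(** * The polar form in characteristic 2 *)

Section Forms.
Set Implicit Arguments.
Unset Strict Implicit.
Unset Printing Implicit Defensive.
Variables (K : fieldType) (V : vectType K).
Local Notation invariant := Defs.invariant.

(** npart_adj phi is the adjoint of npart phi for isometries phi, and nnorm phi is
    the norm of npart phi for the involution of K[phi] that inverts phi. *)
Definition npart (phi : 'End(V)) : 'End(V) := phi - \1%VF.
Definition npart_adj (phi : 'End(V)) : 'End(V) := (phi^-1)%VF - \1%VF.
Definition nnorm (phi : 'End(V)) : 'End(V) := (npart phi \o npart_adj phi)%VF.

Lemma npartE (phi : 'End(V)) v : npart phi v = phi v - v.
Proof. by rewrite /npart add_lfunE opp_lfunE id_lfunE. Qed.

Lemma npart_adjE (phi : 'End(V)) v : npart_adj phi v = (phi^-1)%VF v - v.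
Proof. by rewrite /npart_adj add_lfunE opp_lfunE id_lfunE. Qed.

Lemma npartK (phi : 'End(V)) v : phi v = npart phi v + v.
Proof. by rewrite npartE subrK. Qed.

Lemma invariant_npart (phi : 'End(V)) (X : {vspace V}) :
  invariant (npart phi) X <-> invariant phi X.
Proof.
split=> /invariantP NX; apply/invariantP=> v Xv.
  by rewrite npartK memvD ?NX.
by rewrite npartE memvB ?NX.
Qed.

Variable Q : V -> K.
Hypotheses (charK : 2%N \in [pchar K]) (quadQ : quadratic_form Q).
Local Notation B := (polar Q).

Lemma addKK (x : K) : x + x = 0. Proof. exact: addrr_pchar2. Qed.
Lemma oppK (x : K) : - x = x. Proof. exact: oppr_pchar2. Qed.
Lemma addVV (v : V) : v + v = 0.
Proof. by rewrite -mulr2n -scaler_nat pcharf0 ?scale0r. Qed.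
Lemma oppV (v : V) : - v = v.
Proof. by apply/eqP; rewrite eq_sym -addr_eq0 addVV. Qed.

Lemma quadZ a v : Q (a *: v) = a ^+ 2 * Q v.
Proof. by case: quadQ. Qed.
Lemma quadD v w : Q (v + w) = Q v + Q w + B v w.
Proof. by rewrite /polar -[_ - Q v - _]addrA -opprD [RHS]addrC subrK. Qed.
Lemma quad0 : Q 0 = 0.
Proof. by rewrite -(scale0r 0) quadZ expr0n mul0r. Qed.

Lemma polarC v w : B v w = B w v.
Proof. by rewrite /polar [w + v]addrC addrAC. Qed.
Lemma polarDl u v w : B (u + v) w = B u w + B v w.
Proof. by case: quadQ => _ /(_ w 1 u v) + _; rewrite /= !scale1r mul1r. Qed.
Lemma polar0l w : B 0 w = 0.
Proof. by apply: (addrI (B 0 w)); rewrite -polarDl !addr0. Qed.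
Lemma polarZl a v w : B (a *: v) w = a * B v w.
Proof. by case: quadQ => _ /(_ w a v 0) + _; rewrite /= !addr0 polar0l addr0. Qed.
Lemma polarDr u v w : B u (v + w) = B u v + B u w.
Proof. by rewrite ![B u _]polarC polarDl. Qed.
Lemma polar0r w : B w 0 = 0. Proof. by rewrite polarC polar0l. Qed.
Lemma polarZr a v w : B v (a *: w) = a * B v w.
Proof. by rewrite ![B v _]polarC polarZl. Qed.
Lemma polarvv v : B v v = 0.
Proof.
rewrite /polar -mulr2n -scaler_nat quadZ pcharf0 // expr0n mul0r sub0r.
by rewrite oppK addKK.
Qed.

Lemma polar_sumr I (r : seq I) P F v :
  B v (\sum_(i <- r | P i) F i) = \sum_(i <- r | P i) B v (F i).
Proof.
apply: (big_morph (B v) (fun x y => polarDr v x y) (polar0r v)).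
Qed.

(** * The nilpotent part of an isometry and its adjoint *)

Section Isometry.
Variable phi : 'End(V).
Hypothesis phiO : in_orthogonal_group Q phi.
Local Notation N := (npart phi).
Local Notation N' := (npart_adj phi).
Local Notation s := (nnorm phi).
Local Notation s_ j := (lfun_exp s j).

(** In K[N] the element s ^ j is N ^ (2 j) times a unit, and N s ^ j is N ^ (2 j + 1)
    times a unit. *)
Definition evenf j v w := B (s_ j v) w.
Definition oddf j v w := B (N (s_ j v)) w.
Local Notation F := evenf.
Local Notation G := oddf.

Lemma orthQ v : Q (phi v) = Q v. Proof. by case: phiO. Qed.
Lemma orthB v w : B (phi v) (phi w) = B v w.
Proof. by rewrite /polar -linearD !orthQ. Qed.
Lemma orth_ker : lker phi == 0%VS.
Proof. by case: phiO => /bij_inj inj _; apply/lker0P. Qed.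
Lemma orthK : cancel phi (phi^-1)%VF. Proof. exact/lker0_lfunK/orth_ker. Qed.
Lemma orthVK : cancel (phi^-1)%VF phi. Proof. exact/lker0_lfunVK/orth_ker. Qed.

Lemma npartD v : N v = phi v + v. Proof. by rewrite npartE oppV. Qed.
Lemma npart_adjD v : N' v = (phi^-1)%VF v + v. Proof. by rewrite npart_adjE oppV. Qed.
Lemma npart_npart_adj v : N (N' v) = s v. Proof. by rewrite /nnorm comp_lfunE. Qed.
Lemma nnormE v : s v = N v + N' v.
Proof.
by rewrite -npart_npart_adj [N (N' v)]npartD !npart_adjD linearD /= orthVK npartD [v + _]addrC.
Qed.
Lemma npart_adj_npart v : N' (N v) = s v.
Proof.
by rewrite nnormE npart_adjD npartD linearD /= orthK npart_adjD addrC [v + _]addrC.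
Qed.
Lemma phi_npart v : phi (N v) = N (phi v).
Proof. by rewrite !npartD linearD. Qed.
Lemma phi_npart_adj v : phi (N' v) = N v.
Proof. by rewrite npart_adjD npartD linearD /= orthVK addrC. Qed.
Lemma phi_nnorm v : phi (s v) = N (N v).
Proof. by rewrite -npart_npart_adj phi_npart phi_npart_adj. Qed.
Lemma npart_nnorm v : N (s v) = s (N v).
Proof. by rewrite -npart_adj_npart npart_npart_adj. Qed.

(** This is the identity N ^ 2 = s phi, a consequence of phi N* = N. It reduces all
    powers of N to the span of 1 and N over K[s]. *)
Lemma npart_sq v : N (N v) = s v + s (N v).
Proof. by rewrite -phi_nnorm npartK npart_nnorm addrC. Qed.
Lemma nnorm_phi v : phi (s v) = s (phi v).
Proof. by rewrite (npartK phi) [phi v]npartK linearD npart_nnorm. Qed.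
Lemma npart_nnorm_exp j v : N (s_ j v) = s_ j (N v).
Proof. exact: (lfun_exp_commute j npart_nnorm). Qed.
Lemma nnorm_nnorm_exp j v : s (s_ j v) = s_ j (s v).
Proof. exact: lfun_exp_commute. Qed.
Lemma phi_nnorm_exp j v : phi (s_ j v) = s_ j (phi v).
Proof. exact: (lfun_exp_commute j nnorm_phi). Qed.

Lemma polar_npart v w : B (N v) w = B v (N' w).
Proof.
rewrite npart_adjE npartE !oppV polarDl polarDr; congr (_ + _).
by rewrite -{1}(orthVK w) orthB.
Qed.
Lemma polar_npart_adj v w : B (N' v) w = B v (N w).
Proof. by rewrite polarC -polar_npart polarC. Qed.
Lemma polar_nnorm v w : B (s v) w = B v (s w).
Proof. by rewrite -npart_npart_adj polar_npart polar_npart_adj npart_npart_adj. Qed.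
Lemma polar_nnorm_exp j v w : B (s_ j v) w = B v (s_ j w).
Proof.
elim: j v w => [|j IHj] v w; first by rewrite !lfun_exp0.
by rewrite lfun_expS polar_nnorm IHj -nnorm_nnorm_exp -lfun_expS.
Qed.

Lemma evenfC j v w : F j v w = F j w v.
Proof. by rewrite /evenf polar_nnorm_exp polarC. Qed.
Lemma evenfDl j u v w : F j (u + v) w = F j u w + F j v w.
Proof. by rewrite /evenf linearD polarDl. Qed.
Lemma evenfZl j a v w : F j (a *: v) w = a * F j v w.
Proof. by rewrite /evenf linearZ polarZl. Qed.
Lemma evenfDr j u v w : F j u (v + w) = F j u v + F j u w.
Proof. exact: polarDr. Qed.
Lemma evenfZr j a v w : F j v (a *: w) = a * F j v w.
Proof. exact: polarZr. Qed.
Lemma oddfDl j u v w : G j (u + v) w = G j u w + G j v w.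
Proof. by rewrite /oddf !linearD polarDl. Qed.
Lemma oddfZl j a v w : G j (a *: v) w = a * G j v w.
Proof. by rewrite /oddf !linearZ polarZl. Qed.
Lemma oddfDr j u v w : G j u (v + w) = G j u v + G j u w.
Proof. exact: polarDr. Qed.
Lemma oddfZr j a v w : G j v (a *: w) = a * G j v w.
Proof. exact: polarZr. Qed.

(** This is the identity N + N* = s. *)
Lemma oddf_sym j v w : G j v w + G j w v = F j.+1 v w.
Proof.
rewrite /evenf lfun_expS nnormE polarDl; congr (_ + _).
by rewrite polar_npart_adj polar_nnorm_exp polarC -npart_nnorm_exp.
Qed.
Lemma oddfC j v w : G j w v = F j.+1 v w + G j v w.
Proof. by rewrite -oddf_sym addrAC addKK add0r. Qed.

(** For j > 0 this is twice a value of oddf. *)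
Lemma evenfvv j v : F j v v = 0.
Proof.
case: j => [|j]; first by rewrite /evenf lfun_exp0 polarvv.
by rewrite -oddf_sym addKK.
Qed.

Lemma evenf_sl i j v w : F j (s_ i v) w = F (i + j) v w.
Proof. by rewrite /evenf -lfun_expD addnC. Qed.
Lemma evenf_sr i j v w : F j v (s_ i w) = F (i + j) v w.
Proof. by rewrite evenfC evenf_sl evenfC. Qed.
Lemma oddf_sl i j v w : G j (s_ i v) w = G (i + j) v w.
Proof. by rewrite /oddf -lfun_expD addnC. Qed.
Lemma oddf_sr i j v w : G j v (s_ i w) = G (i + j) v w.
Proof. by rewrite /oddf -polar_nnorm_exp -npart_nnorm_exp -lfun_expD. Qed.
Lemma evenf_Nl j v w : F j (N v) w = G j v w.
Proof. by rewrite /evenf /oddf npart_nnorm_exp. Qed.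
Lemma evenf_Nr j v w : F j v (N w) = G j w v.
Proof. by rewrite evenfC evenf_Nl. Qed.
Lemma oddf_Nr j v w : G j v (N w) = F j.+1 v w.
Proof. by rewrite /oddf -polar_npart_adj npart_adj_npart -lfun_expS. Qed.
Lemma oddf_Nl j v w : G j (N v) w = F j.+1 v w + G j.+1 v w.
Proof. by rewrite /oddf /evenf -npart_nnorm_exp npart_sq polarDl -npart_nnorm -lfun_expS. Qed.

Lemma oddf_add_diag j u c w : G j (u + c *: w) (u + c *: w) =
  G j u u + c * F j.+1 u w + c ^+ 2 * G j w w.
Proof. by rewrite oddfDl !oddfDr !oddfZl !oddfZr -oddf_sym; ring. Qed.

(** Thus Q is determined on N V by its polar form. *)
Lemma quad_npart v : Q (N v) = B v (N v).
Proof. by rewrite npartD quadD orthQ addKK add0r polarDr polarvv addr0 polarC. Qed.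
Lemma quad_npart_adj v : Q (N' v) = Q (N v).
Proof. by rewrite -phi_npart_adj orthQ. Qed.
Lemma quad_npart_exp i v : Q (N (s_ i v)) = G (i + i) v v.
Proof. by rewrite quad_npart polarC -[B _ _]/(G i v _) oddf_sr. Qed.
Lemma quad_nnorm v : Q (s v) = G 1 v v.
Proof.
rewrite nnormE quadD quad_npart_adj addKK add0r -polar_npart npart_sq polarDl.
have E w : B (s w) v = F 1 w v by rewrite /evenf lfun_expS lfun_exp0.
by rewrite !E evenfvv add0r evenf_Nl.
Qed.
Lemma quad_nnorm_exp i v : Q (s (s_ i v)) = G (i + i).+1 v v.
Proof. by rewrite quad_nnorm oddf_sl oddf_sr addnA addn1. Qed.

Lemma exp_double i v : lfun_exp N i.*2 v = lfun_exp phi i (s_ i v).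
Proof.
elim: i v => [|i IHi] v; first by rewrite !lfun_exp0.
rewrite doubleS !lfun_expS IHi -phi_nnorm.
by rewrite (lfun_exp_commute i (fun v => esym (nnorm_phi v))).
Qed.

Lemma npart_fix i v : N v = 0 -> lfun_exp phi i v = v.
Proof.
move=> Nv; elim: i => [|i IHi]; first by rewrite lfun_exp0.
by rewrite lfun_expS IHi npartK Nv add0r.
Qed.

(** If s ^ (k + 1) = 0, then phi acts as the identity on the image of N s ^ k, so
    that the factors phi in N ^ 2 = s phi disappear in the highest powers. *)
Lemma exp_top_even k v : (forall v, s_ k.+1 v = 0) ->
  lfun_exp N k.*2.+1 v = N (s_ k v).
Proof.
move=> s0; rewrite lfun_expS exp_double.
rewrite (lfun_exp_commute _ (fun v => esym (phi_npart v))).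
by rewrite npart_fix // -phi_nnorm -lfun_expS s0 linear0.
Qed.

Lemma exp_top_odd k v : (forall v, N (s_ k v) = 0) -> lfun_exp N k.*2 v = s_ k v.
Proof. by move=> Ns0; rewrite exp_double npart_fix. Qed.

Lemma exp_double0 k : (forall v, lfun_exp N k.*2 v = 0) <-> (forall v, s_ k v = 0).
Proof.
split=> [N0 v | s0 v]; last by rewrite exp_double s0 linear0.
have := N0 v; rewrite exp_double; elim: k {N0} (s_ k v) => [|k IHk] w.
  by rewrite lfun_exp0.
by rewrite lfun_expS => /(canRL orthK); rewrite linear0; apply: IHk.
Qed.

Lemma exp_doubleS0 k : (forall v, lfun_exp N k.*2.+1 v = 0) <-> (forall v, N (s_ k v) = 0).
Proof.
split=> [N0 v | s0 v]; last by rewrite lfun_expS exp_top_odd.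
have := N0 v; rewrite lfun_expSr exp_double -npart_nnorm_exp; elim: k {N0} (N _) => [|k IHk] w.
  by rewrite lfun_exp0.
by rewrite lfun_expS => /(canRL orthK); rewrite linear0; apply: IHk.
Qed.

(** * Recognizing isometries on generators *)

(** Since N ^ 2 = s + s N and s = N + N*, these values determine the polar form
    between the submodules generated by a and by b. *)
Definition agree a b a' b' := forall j, F j a b = F j a' b' /\ G j a b = G j a' b'.

Lemma agree_sym a b a' b' : agree a b a' b' -> agree b a b' a'.
Proof.
move=> ab j; case: (ab j) (ab j.+1) => _ Gj [Fj _].
by rewrite evenfC [RHS]evenfC oddfC Fj Gj -oddfC; case: (ab j).
Qed.

Lemma agree_npart i a b a' b' : agree a b a' b' ->
  agree (lfun_exp N i a) b (lfun_exp N i a') b'.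
Proof.
move=> ab; elim: i => [|i IHi]; first by rewrite !lfun_exp0.
move=> j; rewrite !lfun_expS !evenf_Nl !oddf_Nl.
by case: (IHi j) (IHi j.+1) => [_ ->] [-> ->].
Qed.

Lemma agree_npart2 i i' a b a' b' : agree a b a' b' ->
  agree (lfun_exp N i a) (lfun_exp N i' b) (lfun_exp N i a') (lfun_exp N i' b').
Proof. by move=> ab; apply/agree_npart/agree_sym/agree_npart/agree_sym. Qed.

(** The conditions on the generators give that g preserves the polar form. Then Q
    composed with g differs from Q by an additive function, which vanishes on the
    generators by assumption, and on the image of N by quad_npart. *)
Lemma isometry_on_generators n m (e : 'I_n -> V) (g : 'End(V)) :
    (forall v, g (N v) = N (g v)) ->
    (forall l l', agree (e l) (e l') (g (e l)) (g (e l'))) ->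
    (forall l, Q (g (e l)) = Q (e l)) ->
  forall x : 'M_(n, m), Q (g (krylov N e x)) = Q (krylov N e x).
Proof.
move=> gN gG gQ.
have gE i v : g (lfun_exp N i v) = lfun_exp N i (g v) by exact: lfun_exp_commute.
have gB1 l i (y : 'M_(n, m)) :
    B (g (lfun_exp N i (e l))) (g (krylov N e y)) =
    B (lfun_exp N i (e l)) (krylov N e y).
  rewrite /krylov linear_sum !polar_sumr; apply: eq_bigr => l' _.
  rewrite linear_sum !polar_sumr; apply: eq_bigr => i' _.
  rewrite linearZ !polarZr /= !gE; congr (_ * _).
  by have [] := agree_npart2 i i' (gG l l') 0; rewrite /evenf !lfun_exp0 => ->.
have gB (x y : 'M_(n, m)) :
    B (g (krylov N e x)) (g (krylov N e y)) = B (krylov N e x) (krylov N e y).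
  move: (krylov N e y) (fun l i => gB1 l i y) => z gz.
  rewrite polarC [RHS]polarC /krylov linear_sum !polar_sumr; apply: eq_bigr => l _.
  rewrite linear_sum !polar_sumr; apply: eq_bigr => i _.
  by rewrite linearZ !polarZr /= polarC gz polarC.
pose P (x : 'M_(n, m)) := Q (g (krylov N e x)) = Q (krylov N e x).
have P0 : P 0 by rewrite /P !linear0.
have PD x y : P x -> P y -> P (x + y).
  by rewrite /P !linearD !quadD gB => -> ->.
have PZ a x : P x -> P (a *: x) by rewrite /P !linearZ !quadZ => ->.
move=> x; rewrite [x]matrix_sum_delta.
apply: (big_ind P) => // l _; apply: (big_ind P) => // i _; apply: PZ.
rewrite /P krylov_single gE; case: (nat_of_ord i) => [|j]; first by rewrite !lfun_exp0.
have [_] := agree_npart2 j j (gG l l) 0; rewrite /oddf !lfun_exp0.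
by rewrite !lfun_expS !quad_npart => E; rewrite polarC -E polarC.
Qed.

Definition pairv u w (i : 'I_2) : V := if i == 0 then u else w.

(** The Gram matrix of u and w for the form f (N ^ (m - 1) v) w has zero diagonal and
    nonzero entries off the diagonal, so the images of u and w under N ^ (m - 1) are
    independent. *)
Lemma pairv_inj m u w : (0 < m)%N -> (forall v, lfun_exp N m v = 0) ->
    B (lfun_exp N m.-1 u) u = 0 -> B (lfun_exp N m.-1 w) w = 0 ->
    B (lfun_exp N m.-1 u) w != 0 -> B (lfun_exp N m.-1 w) u != 0 ->
  injective (@krylov _ _ N 2 m (pairv u w)).
Proof.
move=> m_gt0 N0 uu ww uw wu; apply: krylov_inj => // c.
rewrite big_ord_recl big_ord1 /= /pairv /= => c0.
have := congr1 (B u) c0; have := congr1 (B w) c0.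
rewrite !polar0r !polarDr !polarZr ![B w _]polarC ![B u _]polarC uu ww.
rewrite !mulr0 add0r addr0.
move/eqP; rewrite mulf_eq0 (negPf uw) orbF => /eqP c00.
move/eqP; rewrite mulf_eq0 (negPf wu) orbF => /eqP c01 l.
case: (unliftP 0 l) => [j ->|-> //].
by rewrite ord1.
Qed.

Lemma pairv_inj_even k u w : (forall v, s_ k.+1 v = 0) ->
    G k u u = 0 -> G k w w = 0 -> G k u w != 0 ->
  injective (@krylov _ _ N 2 k.+1.*2 (pairv u w)).
Proof.
move=> s0 uu ww uw; apply: pairv_inj => //=; rewrite ?exp_top_even //.
- exact: (exp_double0 k.+1).2.
- by rewrite -[B _ _]/(G k w u) oddfC /evenf s0 polar0l add0r.
Qed.

Lemma pairv_inj_odd k u w : (forall v, N (s_ k v) = 0) -> F k u w != 0 ->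
  injective (@krylov _ _ N 2 k.*2.+1 (pairv u w)).
Proof.
move=> Ns0 uw; apply: pairv_inj => //=; rewrite ?exp_top_odd //.
- by apply/exp_doubleS0.
- exact: evenfvv.
- exact: evenfvv.
- by rewrite -[B _ _]/(F k w u) evenfC.
Qed.

(** * Normal form of two generators, Jordan blocks of even size *)

Section EvenLength.
Variable k : nat.
Hypotheses (s0 : forall v, s_ k.+1 v = 0) (alt : forall v, G k v v = 0).

Lemma evenf_big j v w : (k < j)%N -> F j v w = 0.
Proof. by move=> lt_kj; rewrite /evenf (lfun_exp_eq0 s0) ?polar0l. Qed.

Lemma oddf_big j v w : (k < j)%N -> G j v w = 0.
Proof. by move=> lt_kj; rewrite /oddf (lfun_exp_eq0 s0) ?linear0 ?polar0l. Qed.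

Lemma oddf_vv_big j v : (k <= j)%N -> G j v v = 0.
Proof. by rewrite leq_eqVlt => /predU1P[<- | /oddf_big->]. Qed.

Lemma oddf_topC v w : G k w v = G k v w.
Proof. by rewrite oddfC evenf_big ?add0r. Qed.

Lemma oddf_top_shift u w c i : G k (u + c *: N (s_ i w)) w = G k u w.
Proof.
rewrite oddfDl oddfZl oddf_Nl evenf_sl oddf_sl evenfvv.
by rewrite [G (i + _) _ _]oddf_big ?addr0 ?mulr0 ?addr0 //; lia.
Qed.

Lemma oddf_shift_diag j u w c i :
  G j (u + c *: N (s_ i w)) (u + c *: N (s_ i w)) =
  G j u u + c * G (i + j.+1) w u + c ^+ 2 * G (i + i + j.+1) w w.
Proof.
by rewrite oddf_add_diag evenf_Nr oddf_sl oddf_Nr evenf_Nl oddf_sl oddf_sr addnA.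
Qed.

(** The values G j u u are killed one by one, from j = k - 1 down to j = 0, and the
    value Q u after them. Adding c N s ^ r w to u changes G (k - r - 1) u u by
    c G k w u, and no value with larger j: the terms linear in c vanish because
    s ^ (k + 1) = 0, the quadratic ones because G k is alternating, too. For r = k
    the same change alters Q u alone. *)
Lemma isotropic_correction u w : G k u w != 0 ->
  exists u', [/\ Q u' = 0, forall j, G j u' u' = 0, G k u' w != 0
    & (forall j, G j w w = 0) -> forall j, F j u' w = F j u w].
Proof.
move=> uw.
pose P r u' := [/\ forall j, (r <= j)%N -> G j u' u' = 0, G k u' w != 0
    & (forall j, G j w w = 0) -> forall j, F j u' w = F j u w].
have Pstep u' c i : (forall j, G j w w = 0) -> (forall j, F j u' w = F j u w) ->
    forall j, F j (u' + c *: N (s_ i w)) w = F j u w.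
  by move=> ww E j; rewrite evenfDl evenfZl evenf_Nl oddf_sl ww mulr0 addr0.
have step r : (r <= k)%N -> exists u', P (k - r)%N u'.
  elim: r => [|r IHr] le_rk.
    by exists u; split=> // j; rewrite subn0; apply: oddf_vv_big.
  case: IHr => [|u' [Gu Gw Fw]]; first by rewrite ltnW.
  pose c := G (k - r.+1)%N u' u' / G k u' w.
  exists (u' + c *: N (s_ r w)); split=> [j le_j||ww].
  - rewrite oddf_shift_diag [G (r + r + _) _ _]oddf_vv_big; last lia.
    rewrite mulr0 addr0; have [->|ne] := eqVneq j (k - r.+1)%N.
      have -> : (r + (k - r.+1).+1 = k)%N by lia.
      by rewrite oddf_topC divfK // addKK.
    by rewrite Gu ?oddf_big ?mulr0 ?addr0 //; lia.
  - by rewrite oddf_top_shift.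
  - by apply: Pstep => //; apply: Fw.
have [u' []] := step k (leqnn k); rewrite subnn => Gu Gw Fw.
exists (u' + (Q u' / G k u' w) *: N (s_ k w)); split=> [|j||ww].
- rewrite quadD quadZ quad_npart_exp oddf_vv_big ?leq_addr // mulr0 addr0 polarZr polarC.
  by rewrite -[B _ _]/(G k w u') [G k w u']oddf_topC divfK // addKK.
- rewrite oddf_shift_diag Gu // [G (k + _)%N _ _]oddf_big; last lia.
  by rewrite [G (k + k + _)%N _ _]oddf_big ?mulr0 ?addr0 //; lia.
- by rewrite oddf_top_shift.
- by apply: Pstep => //; apply: Fw.
Qed.

(** The same descent for the values F j u w: adding c N s ^ r w to w changes the
    one with j = k - r by c G k w u and none with larger j. *)
Lemma evenf_free_partner u w : G k u w != 0 ->
  exists w', G k u w' != 0 /\ forall j, F j u w' = 0.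
Proof.
move=> uw.
have step r : (r <= k.+1)%N -> exists w',
    G k u w' != 0 /\ forall j, (k.+1 - r <= j)%N -> F j u w' = 0.
  elim: r => [|r IHr] le_rk.
    by exists w; split=> // j; rewrite subn0; apply: evenf_big.
  case: IHr => [|w' [uw' Fw']]; first by rewrite ltnW.
  exists (w' + (F (k.+1 - r.+1)%N u w' / G k w' u) *: N (s_ r w')); split=> [|j le_j].
    rewrite oddfDr oddfZr oddf_Nr evenf_sr.
    by rewrite [F (r + _)%N _ _]evenf_big ?mulr0 ?addr0 //; lia.
  rewrite evenfDr evenfZr evenf_Nr oddf_sl; have [->|ne] := eqVneq j (k.+1 - r.+1)%N.
    have -> : (r + (k.+1 - r.+1) = k)%N by lia.
    by rewrite divfK ?addKK // oddf_topC.
  by rewrite Fw' ?[G (r + _)%N _ _]oddf_big ?mulr0 ?addr0 //; lia.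
have [w' []] := step k.+1 (leqnn _); rewrite subnn => uw' Fw'.
by exists w'; split=> // j; apply: Fw'.
Qed.

(** The last correction adds multiples N s ^ i u of the isotropic vector u to w. This
    does not affect F j u w, because G j u u = 0. *)
Lemma hyperbolic_generators u w : G k u w != 0 ->
  exists u' w', [/\ Q u' = 0 /\ forall j, G j u' u' = 0,
    Q w' = 0 /\ forall j, G j w' w' = 0, forall j, F j u' w' = 0 & G k u' w' != 0].
Proof.
case/isotropic_correction=> u1 [Qu Gu uw1 _].
have [w1 [uw2 Fw]] := evenf_free_partner uw1.
have [|w2 [Qw Gw wu FE]] := @isotropic_correction w1 u1; first by rewrite oddf_topC.
exists u1, w2; split=> // [j|]; last by rewrite oddf_topC.
by rewrite evenfC FE // evenfC.
Qed.
End EvenLength.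

(** * Normal form of two generators, Jordan blocks of odd size *)

Section OddLength.
Variable k : nat.
Hypotheses (Ns0 : forall v, N (s_ k.+1 v) = 0).

Lemma oddf_big_odd j v w : (k < j)%N -> G j v w = 0.
Proof.
move=> lt_kj; rewrite /oddf npart_nnorm_exp -(subnKC lt_kj) addnC lfun_expD.
by rewrite -npart_nnorm_exp Ns0 linear0 polar0l.
Qed.

Lemma evenf_big_odd j v w : (k.+1 < j)%N -> F j v w = 0.
Proof. by case: j => // j lt_kj; rewrite -oddf_sym !oddf_big_odd ?addr0. Qed.

(** The function q = G k v v of v is a quadratic form on V / N V with polar form
    F (k + 1). If q b != 0, the transvection a |-> a + (F (k + 1) a b / q b) b is an
    isometry of q, and it moves a if F (k + 1) a b != 0. *)
Lemma balanced_pair u w : F k.+1 u w != 0 ->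
  exists u' w', F k.+1 u' w' != 0 /\ G k u' u' = G k w' w'.
Proof.
have H a b : F k.+1 a b != 0 -> G k b b != 0 ->
    exists u' w', F k.+1 u' w' != 0 /\ G k u' u' = G k w' w'.
  move=> ab bb; exists a, (a + (F k.+1 a b / G k b b) *: b); split.
    by rewrite evenfDr evenfvv add0r evenfZr mulf_neq0 // mulf_neq0 // invr_eq0.
  rewrite oddf_add_diag -addrA expr2 -mulrA divfK // addKK addr0 //.
move=> uw; have [ww|] := eqVneq (G k w w) 0; last exact: (H u w uw).
have [uu|] := eqVneq (G k u u) 0; first by exists u, w; rewrite uu ww.
by apply: (H w u); rewrite evenfC.
Qed.

(** A square root of phi that sends u to w and w to phi u is an isometry exactly if
    the three equations of the conclusion hold. They are achieved by descending
    induction: adding c N s ^ r w to w corrects G (k - r) u w, and adding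
    d s ^ (r + 1) u then corrects G (k - r - 1) w w. Neither step disturbs what was
    achieved before. The correction of Q w comes last. *)
Lemma symmetric_partner u w : F k.+1 u w != 0 -> G k u u = G k w w ->
  exists w', [/\ Q w' = Q u, forall j, G j w' w' = G j u u,
    forall j, G j u w' = 0 & F k.+1 u w' != 0].
Proof.
move=> uw uuww.
have step r : (r <= k.+1)%N -> exists w', [/\ F k.+1 u w' != 0,
    forall j, (k.+1 - r <= j)%N -> G j u w' = 0
    & forall j, (k.+1 - r <= j.+1)%N -> G j w' w' = G j u u].
  elim: r => [|r IHr] le_rk.
    exists w; split=> // j; rewrite subn0; first exact: oddf_big_odd.
    by have [<-|ne] := eqVneq k j => [|le_kj]; rewrite ?uuww // !oddf_big_odd //; lia.
  case: IHr => [|w1 [uw1 Gu Gw]]; first by rewrite ltnW.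
  pose t := (k - r)%N.
  pose c := G t u w1 / F k.+1 u w1.
  pose w2 := w1 + c *: N (s_ r w1).
  have uw2 : F k.+1 u w2 != 0.
    by rewrite evenfDr evenfZr evenf_Nr oddf_sl oddf_big_odd ?mulr0 ?addr0 //; lia.
  have Gu2 j : (t <= j)%N -> G j u w2 = 0.
    rewrite oddfDr oddfZr oddf_Nr evenf_sr leq_eqVlt => /predU1P[<-|lt_tj].
      have -> : (r + t.+1 = k.+1)%N by rewrite /t; lia.
      by rewrite divfK ?addKK.
    rewrite Gu ?[F (r + _)%N _ _]evenf_big_odd ?mulr0 ?addr0 //; rewrite /t in lt_tj; lia.
  have Gw2 j : (t <= j)%N -> G j w2 w2 = G j u u.
    move=> le_tj; rewrite oddf_shift_diag ![G (_ + _) _ _]oddf_big_odd.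
    - by rewrite !mulr0 !addr0 Gw // -/t; lia.
    - by rewrite /t in le_tj; lia.
    - by rewrite /t in le_tj; lia.
  have [t0|t_gt0] := posnP t.
    by exists w2; split=> // j _; apply: Gw2; rewrite t0.
  pose d := (G t.-1 w2 w2 + G t.-1 u u) / F k.+1 u w2.
  exists (w2 + d *: s_ r.+1 u); split=> [|j le_j|j le_j].
  - by rewrite evenfDr evenfZr evenf_sr evenfvv mulr0 addr0.
  - by rewrite oddfDr oddfZr oddf_sr Gu2 ?oddf_big_odd ?mulr0 ?addr0 //; rewrite /t; lia.
  rewrite oddf_add_diag.
  rewrite evenf_sr oddf_sl oddf_sr [G (_ + _) u u]oddf_big_odd ?mulr0 ?addr0; last first.
    by rewrite /t in t_gt0; lia.
  have [->|ne] := eqVneq j t.-1.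
    have -> : (r.+1 + t.-1.+1 = k.+1)%N by rewrite /t in t_gt0 *; lia.
    by rewrite [F _ w2 _]evenfC divfK // addrA addKK add0r.
  rewrite Gw2 ?evenf_big_odd ?mulr0 ?addr0 //; rewrite /t in t_gt0 ne *; lia.
have [w1 [uw1 Gu Gw]] := step k.+1 (leqnn _); rewrite subnn in Gu Gw.
exists (w1 + ((Q w1 + Q u) / F k.+1 u w1) *: s_ k.+1 u); split=> [|j|j|].
- rewrite quadD quadZ lfun_expS quad_nnorm_exp oddf_big_odd; last lia.
  rewrite mulr0 addr0 polarZr -lfun_expS polarC -[B _ _]/(F k.+1 u w1).
  by rewrite divfK // addrA addKK add0r.
- rewrite oddf_add_diag.
  rewrite evenf_sr oddf_sl oddf_sr [G (_ + _) u u]oddf_big_odd ?mulr0 ?addr0; last lia.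
  by rewrite Gw // [F (k.+1 + _)%N _ _]evenf_big_odd ?mulr0 ?addr0 //; lia.
- by rewrite oddfDr oddfZr oddf_sr Gu // oddf_big_odd ?mulr0 ?addr0 //; lia.
- by rewrite evenfDr evenfZr evenf_sr evenfvv mulr0 addr0.
Qed.
End OddLength.
End Isometry.
End Forms.

(** * Elementary divisors and nilpotency *)

Section Type1.
Set Implicit Arguments.
Unset Strict Implicit.
Unset Printing Implicit Defensive.
Variables (K : fieldType) (V : vectType K) (Q : V -> K).
Local Notation invariant := Defs.invariant.
Hypotheses (charK : 2%N \in [pchar K]) (quadQ : quadratic_form Q).
Local Notation B := (polar Q).

Section Horner.
Variable phi : 'End(V).
Implicit Types (p q : {poly K}) (v : V).

Lemma lfun_hornerE p n v : (size p <= n)%N ->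
  lfun_horner p phi v = \sum_(i < n) p`_i *: lfun_exp phi i v.
Proof.
move=> le_pn; rewrite /lfun_horner sum_lfunE.
rewrite -(big_mkord predT (fun i => p`_i *: lfun_exp phi i v)).
rewrite (big_cat_nat _ le_pn) //=.
rewrite [X in _ + X]big1_seq ?addr0; last first.
  move=> i /andP[_]; rewrite mem_index_iota => /andP[le_i _].
  by rewrite nth_default ?scale0r.
by rewrite big_mkord; apply: eq_bigr => i _; rewrite scale_lfunE.
Qed.

Lemma lfun_hornerD p q v :
  lfun_horner (p + q) phi v = lfun_horner p phi v + lfun_horner q phi v.
Proof.
set n := maxn (size p) (size q).
rewrite !(@lfun_hornerE _ n) ?leq_maxl ?leq_maxr ?size_polyD // -big_split.
by apply: eq_bigr => i _; rewrite /= coefD scalerDl.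
Qed.

Lemma lfun_hornerXM p v : lfun_horner ('X * p) phi v = phi (lfun_horner p phi v).
Proof.
rewrite (@lfun_hornerE _ (size p).+1); last first.
  by have [->|p0] := eqVneq p 0; rewrite ?mulr0 ?size_poly0 // mulrC size_mulX.
rewrite (@lfun_hornerE p (size p)) // big_ord_recl coefXM scale0r add0r linear_sum.
by apply: eq_bigr => i _; rewrite linearZ coefXM lfun_expS.
Qed.

Lemma lfun_horner1 v : lfun_horner 1 phi v = v.
Proof.
by rewrite (@lfun_hornerE _ 1) ?size_poly1 // big_ord1 coef1 scale1r lfun_exp0.
Qed.

Lemma lfun_horner_npart n v :
  lfun_horner (('X + 1) ^+ n) phi v = lfun_exp (npart phi) n v.
Proof.
elim: n => [|n IHn]; first by rewrite expr0 lfun_horner1 lfun_exp0.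
rewrite exprS mulrDl mul1r lfun_hornerD lfun_hornerXM IHn lfun_expS.
by rewrite npartE (oppV charK).
Qed.
End Horner.

Lemma size_exp_X1 n : size (('X + 1) ^+ n : {poly K}) = n.+1.
Proof. by have := size_exp_XsubC n (-1 : K); rewrite polyCN opprK polyC1. Qed.

Lemma monic_exp_X1 n : ('X + 1) ^+ n \is @monic K.
Proof. by rewrite monic_exp // -(opprK 1) -polyC1 -polyCN monicXsubC. Qed.

Lemma dvdp_exp_X1 m n : (('X + 1) ^+ m : {poly K}) %| ('X + 1) ^+ n -> (m <= n)%N.
Proof.
move/dvdp_leq; rewrite !size_exp_X1 ltnS; apply.
by rewrite -size_poly_gt0 size_exp_X1.
Qed.

(** The submodule generated by the two vectors v i is free of rank 2 over
    K['X] / ('X ^ m), with 'X acting as N, and it is all of V. *)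
Lemma type1_invariants (phi : 'End(V)) (m : nat) : (0 < m)%N ->
  elementary_divisors phi [:: ('X + 1) ^+ m; ('X + 1) ^+ m] ->
  [/\ forall v, lfun_exp (npart phi) m v = 0,
      exists v, lfun_exp (npart phi) m.-1 v != 0,
      \dim {:V} = (2 * m)%N
    & is_minimal_polynomial phi (('X + 1) ^+ m)].
Proof.
move=> m_gt0 [_ [/= v [ann dir sumV]]].
have nthE (i : 'I_2) : [:: ('X + 1) ^+ m; ('X + 1) ^+ m]`_i = ('X + 1) ^+ m :> {poly K}.
  by case: i => [[|[|]]].
have annE i (q : {poly K}) : lfun_horner q phi (v i) = 0 <-> ('X + 1) ^+ m %| q.
  by rewrite -(nthE i).
have Nv i : lfun_exp (npart phi) m (v i) = 0.
  by rewrite -lfun_horner_npart; apply/annE.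
have N1v i : lfun_exp (npart phi) m.-1 (v i) != 0.
  by apply/eqP; rewrite -lfun_horner_npart => /annE/dvdp_exp_X1; lia.
have sumVE (X : {vspace V}) : invariant phi X -> (forall i, v i \in X) -> X = fullv.
  move=> phiX vX; apply/eqP; rewrite eqEsubv subvf -sumV; apply/subv_sumP=> i _.
  exact: cyclic_span_sub.
have N0 w : lfun_exp (npart phi) m w = 0.
  have : w \in lker (lfun_exp (npart phi) m).
    rewrite (sumVE (lker _)) ?memvf // => [|i]; last by rewrite memv_ker Nv.
    apply/invariant_npart/invariantP=> x; rewrite !memv_ker => /eqP x0.
    by rewrite -lfun_expSr lfun_expS x0 linear0.
  by rewrite memv_ker => /eqP.
have inj : injective (@krylov _ _ (npart phi) 2 m v).
  apply: krylov_inj => // c c0 l.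
  have inC i : c i *: lfun_exp (npart phi) m.-1 (v i) \in cyclic_span phi (v i).
    apply/memvZ/mem_lfun_exp; last exact: mem_cyclic_span.
    by apply/invariant_npart/cyclic_span_invariant.
  have/directv_sum_independent/(_ _ (fun i _ => inC i) c0 l isT)/eqP := dir.
  by rewrite scaler_eq0 (negbTE (N1v _)) orbF => /eqP.
split=> //; first by exists (v ord0).
  rewrite -(krylov_dim inj) (sumVE (limg _)) // => [|i].
    exact/invariant_npart/krylov_invariant.
  exact: krylov_mem.
split; first exact: monic_exp_X1.
  by apply/lfunP=> w; rewrite lfun_horner_npart N0 zero_lfunE.
by move=> q q0; apply/(annE ord0); rewrite q0 zero_lfunE.
Qed.

Lemma minimal_polynomial_unique (phi : 'End(V)) (p q : {poly K}) :
  is_minimal_polynomial phi p -> is_minimal_polynomial phi q -> p = q.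
Proof.
case=> mp p0 pmin [mq q0 qmin]; apply/eqP; rewrite -eqp_monic //.
by rewrite /eqp pmin ?qmin.
Qed.

Lemma polar_nondegenerate (v : V) : nondefective Q -> v != 0 -> exists w, B v w != 0.
Proof.
move=> ndQ v0; pose b := vbasis {:V}.
case: (pickP (fun i : 'I_(\dim {:V}) => B v b`_i != 0)) => [i|B0].
  by exists b`_i.
case/eqP: v0; apply: (ndQ v (memvf v)) => w _.
rewrite (coord_vbasis (memvf w)) (polar_sumr quadQ) big1 // => i _.
by rewrite (polarZr quadQ) (eqP (negbFE (B0 i))) mulr0.
Qed.

(** Maschke's theorem for the group generated by S, whose order is prime to 2: a
    projection onto U is averaged over the group, where 1/3 = 1. *)
Lemma order3_semisimple (S : 'End(V)) : (forall v, S (S (S v)) = v) -> semisimple S.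
Proof.
move=> S3 U /invariantP SU.
pose P := (projv U + (S \o (projv U \o (S \o S))) + ((S \o S) \o (projv U \o S)))%VF.
have PE v : P v = projv U v + S (projv U (S (S v))) + S (S (projv U (S v))).
  by rewrite !add_lfunE !comp_lfunE.
have PU v : P v \in U by rewrite PE !memvD ?SU ?SU ?memv_proj.
have Pid v : v \in U -> P v = v.
  by move=> Uv; rewrite PE !projv_id ?SU ?SU // !S3 addVV // add0r.
have PS v : P (S v) = S (P v).
  by rewrite !PE !linearD /= !S3 -addrA addrC.
exists (lker P); split.
- apply/invariantP=> v; rewrite !memv_ker PS => /eqP->.
  by rewrite linear0.
- apply/eqP; rewrite eqEsubv subvf; apply/subvP=> v _.
  rewrite -(subrK (P v) v) addrC memv_add // memv_ker linearB /=.
  by rewrite (Pid (P v)) ?subrr.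
- apply/eqP; rewrite -subv0; apply/subvP=> v; rewrite memv_cap memv_ker memv0.
  by case/andP=> Uv; rewrite Pid.
Qed.

Section Isometry.
Variable phi : 'End(V).
Hypothesis phiO : in_orthogonal_group Q phi.
Local Notation N := (npart phi).
Local Notation s_ j := (lfun_exp (nnorm phi) j).
Local Notation F := (evenf Q phi).
Local Notation G := (oddf Q phi).

(** As phi maps X onto itself, the orthogonal of X is invariant as well. *)
Lemma invariant_orthogonal (X : {vspace V}) v : invariant phi X ->
  (forall x, x \in X -> B v x = 0) -> forall x, x \in X -> B (N v) x = 0.
Proof.
move=> phiX vX x Xx.
have imX : (phi @: X)%VS = X.
  apply/eqP; rewrite eqEdim [X in X && _]phiX limg_dim_eq ?leqnn //.
  by rewrite (eqP (orth_ker phiO)) capv0.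
move: (Xx); rewrite -{1}imX => /memv_imgP[y Xy xE].
rewrite (npartD charK) (polarDl quadQ) vX // addr0 xE.
by rewrite (orthB phiO) vX.
Qed.

(** Suppose that G k v v != 0. Then the submodule X generated by v is nondefective:
    powers of N map a nonzero vector of its radical to a nonzero multiple of
    N ^ (m - 1) v, where m = 2 k + 2, and this would still be orthogonal to v. But X
    is proper, because its dimension is m. *)
Lemma indecomposable_top_alternating k :
    orthogonally_indecomposable Q phi -> (forall v, s_ k.+1 v = 0) ->
    \dim {:V} = (2 * k.+1.*2)%N ->
  forall v, G k v v = 0.
Proof.
move=> [_ indec] s0 dimV v; apply/eqP/negPn/negP=> top.
have N0 : forall v, lfun_exp N k.+1.*2 v = 0 by apply/(exp_double0 charK phiO).
have topE w : lfun_exp N k.*2.+1 w = N (s_ k w) by rewrite (exp_top_even charK phiO).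
have vtop : N (s_ k v) != 0.
  by apply: contra top; rewrite /oddf => /eqP->; rewrite (polar0l quadQ).
pose e := fun _ : 'I_1 => v; pose X := limg (linfun (@krylov _ _ N 1 k.+1.*2 e)).
have inj : injective (@krylov _ _ N 1 k.+1.*2 e).
  apply: krylov_inj => // c; rewrite big_ord1 /= topE => /eqP.
  by rewrite scaler_eq0 (negPf vtop) orbF => /eqP c0 l; rewrite ord1.
have dimX : \dim X = k.+1.*2 by rewrite krylov_dim // mul1n.
have phiX : invariant phi X by apply/invariant_npart/krylov_invariant.
case: (indec X phiX) => [|X0|XV]; last 2 first.
- by have := dimX; rewrite X0 dimv0.
- by have := dimX; rewrite XV dimV; lia.
move=> _ /memv_imgP[x _ ->]; rewrite lfunE /= => rad.
have [->|x0] := eqVneq x 0; first by rewrite linear0.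
have [] := krylov_lowest (ltn0Sn _) N0 e x0; move=> a [c [[l cl]]].
rewrite big_ord1 /= topE => E.
have vX : v \in X by apply: (@krylov_mem _ _ N 1 k.+1.*2 _ e ord0).
have radN y : y \in X -> B (lfun_exp N a (krylov N e x)) y = 0.
  elim: a {E} y => [|a IHa] y Xy; first by rewrite lfun_exp0; apply: rad.
  by rewrite lfun_expS; apply: (invariant_orthogonal phiX).
have := radN v vX.
rewrite E (polarZl quadQ) => /eqP; rewrite mulf_eq0 -[B _ _]/(G k v v) (negPf top) orbF.
by rewrite ord1 in cl; rewrite (negPf cl).
Qed.

(** S is a power of phi S: the exponents 4 ^ e are 1 modulo 3, and the powers
    phi ^ (4 ^ e) = 1 + N ^ (4 ^ e) reach the identity. So a phi S-invariant subspace
    is invariant under both S and phi. *)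
Lemma cyclic_of_order3 (S : 'End(V)) m (u : V) :
    (forall v, lfun_exp N m v = 0) -> (forall v, S (phi v) = phi (S v)) ->
    (forall v, S (S (S v)) = v) ->
    (forall X, invariant phi X -> u \in X -> S u \in X -> X = fullv) ->
  cyclic_lfun (phi \o S)%VF.
Proof.
move=> N0 Sphi S3 gen; exists u; set X := cyclic_span _ _.
have SN v : S (N v) = N (S v) by rewrite !npartE linearB /= Sphi.
have etaX : invariant (phi \o S)%VF X by exact: cyclic_span_invariant.
have pow e : exists n, forall v,
    lfun_exp (phi \o S)%VF n v = S (v + lfun_exp N (4 ^ e) v).
  elim: e => [|e [n IHe]].
    exists 1%N => v; rewrite !lfun_expS !lfun_exp0 comp_lfunE -Sphi.
    by rewrite [phi v]npartK addrC.
  exists (n + n + (n + n))%N => v.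
  set Y := lfun_exp N (4 ^ e) in IHe.
  have SY w : S (Y w) = Y (S w) by exact: lfun_exp_commute.
  have sq w : lfun_exp (phi \o S)%VF (n + n) w = S (S (w + Y (Y w))).
    rewrite lfun_expD !IHe !linearD /= !SY -!addrA; congr (_ + _).
    by rewrite addrA addVV // add0r.
  rewrite lfun_expD !sq; have -> : lfun_exp N (4 ^ e.+1) v = Y (Y (Y (Y v))).
    by rewrite /Y -!lfun_expD; congr (lfun_exp _ _ _); rewrite expnS; lia.
  rewrite !linearD /= !SY !S3 -!addrA; congr (_ + _).
  by rewrite addrA addVV // add0r.
have SX v : v \in X -> S v \in X.
  have [n nE] := pow m; move=> /(mem_lfun_exp n etaX).
  rewrite nE (lfun_exp_eq0 N0) ?addr0 //.
  by apply: ltnW; apply: ltn_expl.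
have uX : u \in X by exact: mem_cyclic_span.
apply: gen => //; last exact: SX.
apply/invariantP=> v Xv; rewrite -(S3 v) -comp_lfunE.
by move/invariantP: etaX; apply; apply: (SX); apply: (SX).
Qed.

Lemma two_ord (P : 'I_2 -> Prop) : P ord0 -> P (lift ord0 ord0) -> forall l, P l.
Proof. by move=> P0 P1 l; case: (unliftP ord0 l) => [j ->|->//]; rewrite ord1. Qed.

(** * Hyperbolicity and the Jordan-Chevalley decomposition *)

Section Even.
Variable k : nat.
Hypotheses (s0 : forall v, s_ k.+1 v = 0) (dimV : \dim {:V} = (2 * k.+1.*2)%N).
Variables u w : V.
Hypotheses (Qu : Q u = 0) (Gu : forall j, G j u u = 0) (Qw : Q w = 0)
  (Gw : forall j, G j w w = 0) (Fuw : forall j, F j u w = 0) (Guw : G k u w != 0).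
Local Notation m := k.+1.*2.
Local Notation kry := (@krylov _ _ N 2 m (pairv u w)).

Lemma even_exp0 v : lfun_exp N m v = 0.
Proof. by move: v; apply/(exp_double0 charK phiO). Qed.

Lemma even_inj : injective kry.
Proof. exact: (pairv_inj_even charK quadQ phiO s0). Qed.

Lemma even_span v : exists x, v = kry x.
Proof. by apply: krylov_surj; [exact: even_inj | rewrite dimV]. Qed.

Lemma isotropic_krylov a : Q a = 0 -> (forall j, G j a a = 0) ->
  totally_isotropic Q (limg (linfun (@krylov _ _ N 1 m (fun=> a)))).
Proof.
move=> Qa Ga _ /memv_imgP[x _ ->]; rewrite lfunE /=.
(* On an isotropic submodule Q agrees with its composition with the zero map. *)
rewrite -(@isometry_on_generators _ _ _ charK quadQ _ phiO _ _ _ 0) => [|v|l l'|l].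
- by rewrite zero_lfunE (quad0 quadQ).
- by rewrite !zero_lfunE linear0.
- move=> j; rewrite !zero_lfunE evenfvv // evenfvv // Ga; split=> //.
  by rewrite /oddf !linear0 (polar0l quadQ).
- by rewrite zero_lfunE (quad0 quadQ).
Qed.

Lemma even_hyperbolic : hyperbolic Q phi.
Proof.
pose L a := limg (linfun (@krylov _ _ N 1 m (fun=> a))).
have Linv a : invariant phi (L a).
  by apply/invariant_npart/krylov_invariant/even_exp0.
have Lmem a : a \in L a by exact: (@krylov_mem _ _ N 1 m _ (fun=> a) ord0).
have Ldim a : (\dim (L a) <= m)%N.
  have := limg_ker_dim (linfun (@krylov _ _ N 1 m (fun=> a))) fullv.
  rewrite dimvf => dimE; have {}dimE : (_ + \dim (L a) = 1 * m)%N := dimE.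
  by lia.
have LV : (L u + L w)%VS = {:V}%VS.
  apply/eqP; rewrite eqEsubv subvf; apply/subvP=> v _; have [x ->] := even_span v.
  apply: krylov_sub.
    apply/invariant_npart; rewrite /Defs.invariant limgD addvS //; exact: Linv.
  apply: two_ord; first exact: (subvP (addvSl _ _) _ (Lmem u)).
  exact: (subvP (addvSr _ _) _ (Lmem w)).
exists (L u), (L w); split=> //; try by split=> //; apply: isotropic_krylov.
apply/eqP; rewrite -dimv_eq0 -leqn0.
have := dimv_sum_cap (L u) (L w); rewrite LV dimV.
by have := Ldim u; have := Ldim w; lia.
Qed.

(** The semisimple factor S is given by u |-> w |-> u + w. Its minimal polynomial
    X ^ 2 + X + 1 has distinct roots over every K, also over the field with two
    elements, whereas diag (a, 1/a) with respect to u, w needs an a with a ^ 2 != 1. *)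
Lemma even_jordan_chevalley : exists eta etaS : 'End(V),
  [/\ in_orthogonal_group Q eta, cyclic_lfun eta & jordan_chevalley eta phi etaS].
Proof.
have [|S [SN Se]] := @krylov_extend _ _ N 2 m (ltn0Sn _) even_exp0
  (pairv u w) (pairv w (u + w)) even_inj.
  by rewrite dimV.
have Su : S u = w := Se ord0.
have Sw : S w = u + w := Se (lift ord0 ord0).
have Sphi v : S (phi v) = phi (S v).
  by rewrite (npartK phi) [phi (S v)]npartK linearD /= SN.
have S2 v : S (S v) = S v + v.
  have [x ->] := even_span v; rewrite -[S (S _)]comp_lfunE.
  rewrite -[X in _ + X](id_lfunE (kry x)) -add_lfunE.
  apply: krylov_eq => [v'|v'|].
  - by rewrite !comp_lfunE !SN.
  - by rewrite ![(S + _) _]add_lfunE !id_lfunE linearD /= SN.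
  apply: two_ord; rewrite /pairv comp_lfunE add_lfunE id_lfunE /=.
    by rewrite Su Sw addrC.
  by rewrite Sw linearD /= Su Sw addrC.
have S3 v : S (S (S v)) = v.
  by rewrite !S2 [S v + v]addrC -addrA addVV // addr0.
have SQ v : Q (S v) = Q v.
  have [x ->] := even_span v.
  have H01 : agree Q phi u w (S u) (S w).
    move=> j; rewrite Su Sw evenfDr // oddfDr // evenfvv // Gw !addr0.
    by split; [rewrite evenfC | rewrite [RHS]oddfC // Fuw add0r].
  apply: (isometry_on_generators charK quadQ phiO SN).
    apply: two_ord; apply: two_ord => //=; rewrite /pairv /=.
    - by move=> j; rewrite !Su !evenfvv // Gu Gw.
    - exact: agree_sym.
    - move=> j; rewrite !Sw !evenfvv // oddfDl // !oddfDr // Gu Gw.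
      by rewrite add0r addr0 oddf_sym // Fuw.
  apply: two_ord; rewrite /pairv /= ?Su ?Sw ?Qu ?Qw //.
  rewrite quadD // Qu Qw !add0r -(Fuw 0) /evenf lfun_exp0 //.
exists (phi \o S)%VF, S; split.
- split=> [|v]; last by rewrite comp_lfunE (orthQ phiO).
  apply: (eq_bij (f := phi \o S)); last by move=> v; rewrite comp_lfunE.
  apply: bij_comp; first by case: phiO.
  by exists (S \o S) => v /=; rewrite S3.
- apply: (@cyclic_of_order3 S m u even_exp0) => // X phiX uX SuX.
  apply/eqP; rewrite eqEsubv subvf; apply/subvP=> v _; have [x ->] := even_span v.
  apply: krylov_sub; first by apply/invariant_npart.
  by apply: two_ord => //; rewrite /pairv /= -Su.
- split=> //; first by apply/lfunP=> v; rewrite !comp_lfunE Sphi.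
    by exists m; apply/lfunP=> v; rewrite zero_lfunE; exact: even_exp0.
  exact: order3_semisimple.
Qed.
End Even.

(** * Square roots *)

(** Let M = psi - 1 and let S be the norm of M. Then M ^ 2 = N and S ^ 2 = s, so
    N s ^ k = psi S ^ (2 k + 1) and f (M S ^ (2 k + 1) v) v = G k v v = 0. If
    M S ^ (2 k + 1) != 0, then psi has two Jordan blocks of size 4 k + 4. Otherwise
    S ^ (2 k + 1) != 0 still holds, and psi has two Jordan blocks of size 4 k + 3.
    In both cases they do not fit into V, whose dimension is 4 k + 4. *)
Lemma even_no_root k (psi : 'End(V)) : nondefective Q ->
    (forall v, s_ k.+1 v = 0) -> (forall v, G k v v = 0) ->
    (exists v, N (s_ k v) != 0) -> \dim {:V} = (2 * k.+1.*2)%N ->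
    in_orthogonal_group Q psi -> (psi \o psi)%VF <> phi.
Proof.
move=> ndQ s0 alt [v0 v0N] dimV psiO psi2.
have psiE v : psi (psi v) = phi v by rewrite -psi2 comp_lfunE.
pose M := npart psi; pose S := nnorm psi.
have M2 v : M (M v) = N v.
  rewrite !(npartD charK) linearD /= psiE -addrA [psi v + (_ + _)]addrA.
  by rewrite addVV // add0r.
have SM2 v : psi (S v) = M (M v) by rewrite (phi_nnorm charK psiO).
have S2 v : S (S v) = nnorm phi v.
  apply: (bij_inj phiO.1); rewrite (phi_nnorm charK phiO) -psiE.
  by rewrite [psi (S (S v))](nnorm_phi charK psiO) -/S !SM2 !M2.
have Sdouble j v : lfun_exp S j.*2 v = s_ j v.
  elim: j v => [|j IHj] v; first by rewrite !lfun_exp0.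
  by rewrite doubleS !lfun_expS S2 IHj.
have S0 v : lfun_exp S k.*2.+2 v = 0 by rewrite -doubleS Sdouble.
have topE v : N (s_ k v) = psi (lfun_exp S k.*2.+1 v).
  by rewrite lfun_expS SM2 M2 Sdouble.
have alt' v : oddf Q psi k.*2.+1 v v = 0.
  have := alt v; rewrite {1}/oddf topE [psi _]npartK polarDl //.
  by rewrite -[B (lfun_exp _ _ _) _]/(evenf Q psi k.*2.+1 v v) evenfvv // addr0.
have dim_le n (e : 'I_2 -> V) : injective (@krylov _ _ M 2 n e) -> (n <= k.+1.*2)%N.
  move=> inj; have := dimvS (subvf (limg (linfun (@krylov _ _ M 2 n e)))).
  by rewrite krylov_dim // dimV; lia.
have [top0|/lfunPn[v]] := eqVneq (M \o lfun_exp S k.*2.+1)%VF 0.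
  have Ms0 v : M (lfun_exp S k.*2.+1 v) = 0 by rewrite -comp_lfunE top0 zero_lfunE.
  have [|b vb] := @polar_nondegenerate (lfun_exp S k.*2.+1 v0) ndQ.
    by apply: contraNneq v0N => v00; rewrite topE v00 linear0.
  by have := dim_le _ _ (pairv_inj_odd charK quadQ psiO Ms0 vb); lia.
rewrite comp_lfunE zero_lfunE => /(polar_nondegenerate ndQ)[b vb].
have := dim_le _ _ (pairv_inj_even charK quadQ psiO S0 (alt' v) (alt' b) vb); lia.
Qed.

Section Odd.
Variable k : nat.
Hypotheses (Ns0 : forall v, N (s_ k.+1 v) = 0) (dimV : \dim {:V} = (2 * k.+1.*2.+1)%N).
Variables u w : V.
Hypotheses (Qw : Q w = Q u) (Gw : forall j, G j w w = G j u u)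
  (Guw : forall j, G j u w = 0) (Fuw : F k.+1 u w != 0).
Local Notation m := k.+1.*2.+1.

Lemma odd_root :
  exists psi : 'End(V), in_orthogonal_group Q psi /\ (psi \o psi)%VF = phi.
Proof.
have N0 v : lfun_exp N m v = 0 by move: v; apply/(exp_doubleS0 charK phiO).
have inj : injective (@krylov _ _ N 2 m (pairv u w)).
  exact: (pairv_inj_odd charK quadQ phiO Ns0).
have span v : exists x : 'M_(2, m), v = krylov N (pairv u w) x.
  by apply: krylov_surj => //; rewrite dimV.
have [|psi [psiN psie]] := @krylov_extend _ _ N 2 m (ltn0Sn _) N0
  (pairv u w) (pairv w (phi u)) inj.
  by rewrite dimV.
have psiu : psi u = w := psie ord0.
have psiw : psi w = phi u := psie (lift ord0 ord0).
have psi_phi v : psi (phi v) = phi (psi v).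
  by rewrite (npartK phi) [phi (psi v)]npartK linearD /= psiN.
have psi2 v : psi (psi v) = phi v.
  have [x ->] := span v; rewrite -comp_lfunE.
  apply: krylov_eq => [v'|v'|].
  - by rewrite !comp_lfunE !psiN.
  - exact: phi_npart.
  apply: two_ord; rewrite /pairv comp_lfunE /=.
    by rewrite psiu psiw.
  by rewrite psiw psi_phi psiu.
exists psi; split; last by apply/lfunP=> v; rewrite comp_lfunE psi2.
split.
  case: phiO.1 => g gK Kg; exists (psi \o g) => v /=.
    by apply: (bij_inj phiO.1); rewrite -psi_phi Kg psi2.
  by rewrite psi2 Kg.
move=> v; have [x ->] := span v.
have H01 : agree Q phi u w (psi u) (psi w).
  move=> j; rewrite psiu psiw [phi u]npartK evenfDr // oddfDr // evenf_Nr // oddf_Nr //.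
  rewrite Guw add0r; split; first by rewrite evenfC.
  by rewrite oddfC // [evenf _ _ _ w u]evenfC // Guw addr0 addKK.
apply: (isometry_on_generators charK quadQ phiO psiN).
  apply: two_ord; apply: two_ord => //=; rewrite /pairv /=.
  - by move=> j; rewrite psiu !evenfvv // Gw.
  - exact: agree_sym.
  - move=> j; rewrite psiw !evenfvv // Gw; split=> //.
    by rewrite /oddf -(phi_nnorm_exp charK phiO) -(phi_npart charK) (orthB phiO).
by apply: two_ord; rewrite /pairv /= ?psiu ?psiw ?orthQ.
Qed.
End Odd.

End Isometry.
End Type1.

Theorem proposition1p7 (K : fieldType) (V : vectType K) (Q : V -> K)
    (phi : 'End(V)) (charK : 2%N \in [pchar K])
    (quadQ : quadratic_form Q) (ndQ : nondefective Q)
    (phiO : in_orthogonal_group Q phi)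
    (indec : orthogonally_indecomposable Q phi) (phi1 : type1 phi) :
  (type1e phi ->
     hyperbolic Q phi /\
     exists eta etaS : 'End(V),
       [/\ in_orthogonal_group Q eta, cyclic_lfun eta
         & jordan_chevalley eta phi etaS]) /\
  ((exists psi : 'End(V), in_orthogonal_group Q psi /\ (psi \o psi)%VF = phi)
     <-> type1o phi).
Proof.
have [_ [m [m_gt0 es]]] := phi1.
have [N0 [v v0] dimV minm] := type1_invariants charK m_gt0 es.
have degree p : is_minimal_polynomial phi p -> (size p).-1 = m.
  by move=> /minimal_polynomial_unique/(_ minm)->; rewrite size_exp_X1.
have type1oE : type1o phi <-> odd m.
  split=> [[_ [p [/degree<-]]] // | odd_m].
  by split=> //; exists (('X + 1) ^+ m); rewrite (degree _ minm).
have type1eE : type1e phi -> ~~ odd m by case=> _ [p [/degree<-]].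
have [odd_m|even_m] := boolP (odd m).
  split=> [/type1eE|]; first by rewrite odd_m.
  split=> [_|_]; first exact/type1oE.
  have mE : m = m./2.*2.+1 by lia.
  case: (m./2) mE => [|k] mE.
    (* Here m = 1 and phi is the identity. *)
    exists \1%VF; split.
      split=> [|w]; last by rewrite id_lfunE.
      by exists id => w; rewrite id_lfunE.
    rewrite comp_lfun1l; apply/lfunP=> w; rewrite id_lfunE npartK.
    by have := N0 w; rewrite mE lfun_expS lfun_exp0 => ->; rewrite add0r.
  have Ns0 : forall v, npart phi (lfun_exp (nnorm phi) k.+1 v) = 0.
    by apply/(exp_doubleS0 charK phiO) => w; rewrite -mE.
  have [b vb] : exists b, evenf Q phi k.+1 v b != 0.
    apply: polar_nondegenerate => //.
    by rewrite -(exp_top_odd charK phiO) // -[_.*2]/(_.*2.+1.-1) -mE.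
  have [u [w [uw uuww]]] := balanced_pair charK quadQ phiO vb.
  have [w' [Qw Gw Guw Fuw]] := symmetric_partner charK quadQ phiO Ns0 uw uuww.
  by apply: (odd_root charK quadQ phiO Ns0 _ Qw Gw Guw Fuw); rewrite dimV {1}mE.
have [k mE] : exists k, m = k.+1.*2 by exists m./2.-1; lia.
have s0 : forall v, lfun_exp (nnorm phi) k.+1 v = 0.
  by apply/(exp_double0 charK phiO) => w; rewrite -mE.
have topv : npart phi (lfun_exp (nnorm phi) k v) != 0.
  by rewrite -(exp_top_even charK phiO) // -[_.+1]/(k.+1.*2.-1) -mE.
have alt : forall v, oddf Q phi k v v = 0.
  by apply: indecomposable_top_alternating => //; rewrite dimV mE.
split=> [_|]; last first.
  split=> [[psi [psiO psi2]]|/type1oE]; last by rewrite (negPf even_m).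
  have [] := even_no_root charK quadQ phiO ndQ s0 alt _ _ psiO psi2; first by exists v.
  by rewrite dimV mE.
have [b vb] := polar_nondegenerate quadQ ndQ topv.
have [u [w [[Qu Gu] [Qw Gw] Fuw Guw]]] :=
  hyperbolic_generators charK quadQ phiO s0 alt vb.
have dimV' : \dim {:V} = (2 * k.+1.*2)%N by rewrite dimV mE.
split; first exact: even_hyperbolic Guw.
exact: even_jordan_chevalley Guw.
Qed.
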